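(* Let $X$ be a (real) Banach space, $g:X\to\overline{\mathbb R}$ proper, convex and lower semicontinuous, and $h:X\to\mathbb R$ convex and continuous. Assume that $f=g-h$ is bounded from below and that at least one of $g$ and $h$ is strongly convex. Let $(u^k)_{k\ge0}\subseteq X$ be a sequence generated by the inexact DC-Algorithm with associated sequences $(s^k)_{k\ge0},(\varepsilon^k)_{k\ge0}\subseteq X'$, i.e., $u^0\in X$ and $$s^k\in\partial h(u^k),\qquad s^k+\varepsilon^k\in\partial g(u^{k+1})\qquad\text{for all }k\ge0.$$ Suppose that there is a subsequence indexed by $(k_n)$ such that $u^{k_n}\to\bar u$ in $X$ and $s^{k_n}\rightharpoonup^*\bar s$ in $X'$ (weak-* convergence). Suppose in addition $$\sum_{k=1}^\infty\|\varepsilon^k\|_{X'}^2<\infty.$$ Then $\bar s\in\partial g(\bar u)\cap\partial h(\bar u)$, i.e., $\bar u$ is a critical point of $f=g-h$.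
   Context: $\overline{\mathbb R}$ denotes the extended reals. A function $g:X\to\overline{\mathbb R}$ is proper if $g>-\infty$ everywhere and $g(u)<\infty$ for some $u$. $\partial$ denotes the convex subdifferential: $\partial g(u)=\{s\in X'\mid g(v)-g(u)\ge\langle s,v-u\rangle\ \forall v\in X\}$. A function $\phi$ is strongly convex if there is $\alpha>0$ such that $\phi(\lambda u+(1-\lambda)v)\le\lambda\phi(u)+(1-\lambda)\phi(v)-\frac{\alpha}{2}\lambda(1-\lambda)\|u-v\|_X^2$ for all $u,v\in X$, $\lambda\in[0,1]$. A point $u\in X$ is a critical point of $f=g-h$ if $\partial g(u)\cap\partial h(u)\ne\emptyset$. *)

(* Defs.v *)
From HB Require Import structures.
From mathcomp Require Import all_boot all_order all_algebra.
From mathcomp Require Import all_classical all_reals all_analysis.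

Set Implicit Arguments.
Unset Strict Implicit.
Unset Printing Implicit Defensive.

Import Order.TTheory GRing.Theory Num.Theory.
Import numFieldNormedType.Exports.

Local Open Scope classical_set_scope.
Local Open Scope ring_scope.

Section dual.
Context {R : realType} (X : normedModType R).

Definition continuous_linear : {pred X -> R^o} :=
  mem [set f : X -> R^o | linear f /\ continuous f].

Record dual := Dual {
  dual_val :> X -> R^o;
  _ : dual_val \in continuous_linear }.

HB.instance Definition _ := [isSub for dual_val].
HB.instance Definition _ := [Choice of dual by <:].

Lemma continuous_linear_submod_closed : submod_closed continuous_linear.
Proof.
split.
  apply/mem_set; split; first by move=> a x y /=; rewrite scaler0 addr0.
  exact: cst_continuous.
move=> a f g /set_mem[fl fc] /set_mem[gl gc]; apply/mem_set; split.
  move=> b x y; rewrite !fctE fl gl !scalerDr addrACA.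
  by rewrite !scalerA (mulrC a b).
move=> x; apply: continuousD; last exact: gc.
by apply: continuousZr; exact: fc.
Qed.

HB.instance Definition _ := GRing.isSubmodClosed.Build _ _ continuous_linear
  continuous_linear_submod_closed.

HB.instance Definition _ := [SubChoice_isSubLmodule of dual by <:].

Lemma dual_linear (s : dual) : linear s.
Proof. by case: s => f /= /set_mem[]. Qed.

Lemma dual_continuous (s : dual) : continuous s.
Proof. by case: s => f /= /set_mem[]. Qed.

Lemma dualDE (s t : dual) (x : X) : (s + t) x = s x + t x.
Proof. by []. Qed.

HB.instance Definition _ (s : dual) :=
  GRing.isLinear.Build R X R^o _ s (dual_linear s).

Definition dual_norm (s : dual) : R :=
  sup [set `|s x| | x in [set x : X | `|x| <= 1]].

(* [dual_norm] never takes the junk value that [sup] has on unbounded sets *)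
Lemma dual_norm_has_sup (s : dual) :
  has_sup [set `|s x| | x in [set x : X | `|x| <= 1]].
Proof.
split; first by exists `|s 0|, 0 => //=; rewrite normr0.
have /linear_bounded_continuous/bounded_funP/(_ 1)[M sM] := @dual_continuous s.
by exists M => _ [x x1 <-]; exact: sM.
Qed.

Lemma dual_normP (s : dual) (x : X) : `|s x| <= dual_norm s * `|x|.
Proof.
have [->|x0] := eqVneq x 0; first by rewrite linear0 !normr0 mulr0.
rewrite -ler_pdivrMr ?normr_gt0//.
apply: (sup_upper_bound (dual_norm_has_sup s)).
exists (`|x|^-1 *: x) => /=.
  by rewrite normrZ normfV normr_id mulVf// normr_eq0.
by rewrite linearZ/= normrM normfV normr_id mulrC.
Qed.

Definition weak_star_cvg (s : nat -> dual) (l : dual) :=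
  forall x : X, s n x @[n --> \oo] --> l x.

End dual.

Section convex_analysis.
Context {R : realType} {X : normedModType R}.
Implicit Types (g : X -> \bar R) (u v : X).

Local Open Scope ereal_scope.

Definition proper_fun g := (forall u, -oo < g u) /\ exists u, g u < +oo.

(* [convex_function] of the library is limited to real-valued functions. In the
   next two definitions [0 * +oo = 0], and [+oo - oo] does not occur when [g]
   is proper. *)
Definition econvex g := forall u v (t : R), (0 <= t <= 1)%R ->
  g (t *: u + (1 - t) *: v)%R <= t%:E * g u + (1 - t)%:E * g v.

Definition strongly_convex g := exists2 a : R, (0 < a)%R &
  forall u v (t : R), (0 <= t <= 1)%R ->
    g (t *: u + (1 - t) *: v)%R <=
    t%:E * g u + (1 - t)%:E * g v
    - (a / 2 * t * (1 - t) * `|u - v| ^+ 2)%:E.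

(* For proper [g] this is empty wherever [g u = +oo]: take [v] in the domain of
   [g]. *)
Definition subdifferential g u : set (dual X) :=
  [set s | forall v, (s (v - u)%R)%:E <= g v - g u].

Definition bounded_below g := exists m : R, forall u, m%:E <= g u.

Definition critical_point g (h : X -> R) u :=
  subdifferential g u `&` subdifferential (EFin \o h) u !=set0.

Definition inexact_DCA g (h : X -> R) (u : nat -> X) (s eps : nat -> dual X) :=
  forall k, subdifferential (EFin \o h) (u k) (s k) /\
            subdifferential g (u k.+1) (s k + eps k)%R.

End convex_analysis.

(* Main.v *)
(* With c > 0 depending on the modulus of strong convexity, adding the two
   subgradient inequalities of step k gives
     c |u_k - u_(k+1)|^2 + eps_k (u_k - u_(k+1)) <= f (u_k) - f (u_(k+1)),
   so Young's inequality and telescoping bound the sum of |u_k - u_(k+1)|^2 by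
   the summable errors, and u_(k_n + 1) also tends to ubar. The graphs of the
   two subdifferentials are closed for norm convergence of the points and
   weak-* convergence of bounded sequences of subgradients. The s_(k_n) are
   bounded because h, being continuous, is bounded near ubar. *)

Require Import Defs.
From mathcomp Require Import all_boot all_order all_algebra.
From mathcomp Require Import all_classical all_reals all_analysis.
From mathcomp Require Import ring lra.

Set Implicit Arguments.
Unset Strict Implicit.
Unset Printing Implicit Defensive.

Import Order.TTheory GRing.Theory Num.Theory.
Import numFieldNormedType.Exports.

Local Open Scope classical_set_scope.
Local Open Scope ring_scope.

Lemma nonneg_bounded_sum_cvg0 (R : realType) (a : R^nat) (M : R) :
  (forall k, 0 <= a k) -> (forall n, \sum_(0 <= k < n) a k <= M) ->
  a k @[k --> \oo] --> 0.
Proof.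
move=> a0 aM; apply: cvg_series_cvg_0; apply: nondecreasing_is_cvgn.
  by apply: nondecreasing_series => k _ _; exact: a0.
by exists M => _ [n _ <-]; exact: aM.
Qed.

Lemma sqr_cvg0 (R : realType) (a : R^nat) :
  a k ^+ 2 @[k --> \oo] --> 0 -> a k @[k --> \oo] --> 0.
Proof.
move=> a20; apply: norm_cvg0.
under eq_fun do rewrite -sqrtr_sqr.
by rewrite -[0]sqrtr0; apply: continuous_cvg => //; exact: sqrt_continuous.
Qed.

(** Turns summability in the extended reals into a real bound on partial sums, namely the sum of the
    series. The shift by [m] serves series that do not start at index 0. *)
Lemma nneseries_lty_bounded (R : realType) (b : R^nat) (m : nat) :
  (forall k, 0 <= b k) -> (\sum_(m <= k <oo) (b k)%:E < +oo)%E ->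
  exists M, forall n, \sum_(0 <= k < n) b (k + m)%N <= M.
Proof.
move=> b0 bS; set S := (\sum_(m <= k <oo) (b k)%:E)%E.
have S0 : (0 <= S)%E by apply: nneseries_ge0 => k _ _; rewrite lee_fin.
exists (fine S) => n.
rewrite -lee_fin fineK ?ge0_fin_numE// -sumEFin.
apply: (@le_trans _ _ (\sum_(m <= k < n + m) (b k)%:E)%E).
  by rewrite -{2}(add0n m) big_addn addnK.
by apply: nneseries_lim_ge => k _ _; rewrite lee_fin.
Qed.

(** Writes the scaling of [R^o] as a product in [R], the form suited to [lra]. *)
Lemma dualZE (R : realType) (X : normedModType R) (s : dual X) (a : R) (x : X) :
  s (a *: x) = (a * (s x : R) : R).
Proof. exact: linearZ. Qed.

Section subdifferential_theory.
Context {R : realType} {X : normedModType R}.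
Implicit Types (g : X -> \bar R) (h : X -> R) (u v : X) (s : dual X).

Lemma subdifferential_fin_num g u s :
  proper_fun g -> subdifferential g u s -> g u \is a fin_num.
Proof.
move=> [gNy [v gv]] /(_ v); rewrite fin_numElt gNy/=.
by case: (g u) => [r|//|//]; [rewrite ltry|rewrite addeNy leeNy_eq].
Qed.

Lemma subdifferential_fineP g u s v :
  proper_fun g -> subdifferential g u s -> g v \is a fin_num ->
  s (v - u) <= fine (g v) - fine (g u).
Proof.
move=> gp su gv; have gu := subdifferential_fin_num gp su.
by have := su v; rewrite -{1}(fineK gv) -{1}(fineK gu) lee_fin.
Qed.

Lemma proper_fun_EFin h : proper_fun (EFin \o h).
Proof. by split=> [u|]; [rewrite ltNyr|exists 0; rewrite ltry]. Qed.

(* The subgradient inequality at the midpoint of [u] and [v] already has a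
   quadratic surplus, so no limit [t -> 0] is needed. *)
Lemma strongly_convex_subdifferential g : proper_fun g -> strongly_convex g ->
  exists2 c : R, 0 < c & forall u v s,
    subdifferential g u s -> g v \is a fin_num ->
    s (v - u) + c * `|v - u| ^+ 2 <= fine (g v) - fine (g u).
Proof.
(* At [t = 1/2] the quadratic term of strong convexity is [a / 8] times the squared distance; the
   subgradient inequality at the midpoint, which involves [s (v - u) / 2], is then doubled. *)
move=> gp [a a0 gsc]; exists (a / 4); first by rewrite divr_gt0.
move=> u v s su gv; have gu := subdifferential_fin_num gp su.
have h01 : 0 <= (2^-1 : R) <= 1 by lra.
have := gsc v u _ h01.
set w := _ *: v + _ => gw.
have wu : w - u = 2^-1 *: (v - u).
  by rewrite /w scalerBl scale1r scalerBr addrA addrAC addrK.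
move: gw; rewrite -(fineK gv) -(fineK gu) -!EFinM -!EFinD => gw.
have gwf : g w \is a fin_num.
  by rewrite fin_numElt (proj1 gp)/= (le_lt_trans gw) ?ltry.
have := subdifferential_fineP gp su gwf.
move: gw; rewrite -(fineK gwf) lee_fin wu dualZE (distrC v u).
set d : R := `|u - v|; set p : R := s (v - u); lra.
Qed.

(** A subgradient at [v] satisfies [s w <= h (v + w) - h v], and by continuity [h] varies by less
    than 2 on a small ball around [u]. Homogeneity turns this into a bound on [s], with one constant
    for all [v] in a smaller ball. *)
Lemma subdifferential_locally_bounded h u : {for u, continuous h} ->
  exists C : R, \forall v \near u, forall s,
    subdifferential (EFin \o h) v s -> forall w, `|s w| <= C * `|w|.
Proof.
move=> /cvgrPdist_lt/(_ 1 ltr01)/nbhs_ballP[d /= d0 hd].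
have d2 : 0 < d / 2 by rewrite divr_gt0.
(* Subgradients are at most 2 on vectors of norm below [d / 2]; rescaling to norm [d / 3], strictly
   below that radius, gives this factor. *)
exists (2 / (d / 3)); apply/nbhs_ballP; exists (d / 2) => //= v uv s sv.
have s2 (w : X) : `|w| < d / 2 -> s w <= 2.
  move=> wd; have := sv (v + w); rewrite addrAC subrr add0r.
  rewrite lee_fin => /le_trans; apply.
  have /hd : ball u d v by apply: le_ball uv; lra.
  have /hd : ball u d (v + w).
    move: uv; rewrite -!ball_normE/= => uv.
    rewrite opprD addrA (le_lt_trans (ler_normB _ _))//.
    by rewrite (splitr d) ltrD.
  by rewrite !ltr_distlC /= => /andP[? ?] /andP[? ?]; lra.
move=> w; have [->|w0] := eqVneq w 0; first by rewrite linear0 !normr0 mulr0.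
have nw : 0 < `|w| by rewrite normr_gt0.
(* Stated for every vector of the same norm, so that it applies to both [w] and [- w]. *)
have s3 (x : X) : `|x| = `|w| -> s x <= 2 / (d / 3) * `|w|.
  move=> xw; have := s2 ((d / 3 / `|w|) *: x).
  rewrite normrZ xw ger0_norm; last by rewrite !divr_ge0// ltW.
  rewrite mulfVK ?gt_eqF// linearZ/= => H.
  have {}H : d / 3 / `|w| * s x <= 2 by apply: H; lra.
  rewrite -ler_pdivrMr// ler_pdivlMr ?divr_gt0//.
  by rewrite mulrC mulrA in H *; rewrite mulrAC.
by rewrite ler_norml s3// andbT lerNl -linearN/= s3// normrN.
Qed.

(* Pointwise convergence of the subgradients suffices because they are
   equicontinuous: this gives [t n (v - x n) --> t0 (v - x0)]. *)
Lemma subdifferential_closed g (x : nat -> X) (t : nat -> dual X) x0 t0 (C : R) :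
  proper_fun g -> lower_semicontinuous g ->
  x n @[n --> \oo] --> x0 -> weak_star_cvg t t0 ->
  (\forall n \near \oo, forall w, `|t n w| <= C * `|w|) ->
  (forall n, subdifferential g (x n) (t n)) ->
  subdifferential g x0 t0.
Proof.
move=> gp glsc xx0 tt0 tC tg.
have tx v : t n (v - x n) @[n --> \oo] --> t0 (v - x0).
  have -> : (fun n => t n (v - x n)) =
            (fun n => t n (v - x0)) + (fun n => t n (x0 - x n)).
    by apply/funext => n; rewrite fctE -linearD addrA subrK.
  rewrite -[t0 _]addr0; apply: cvgD; first exact: tt0.
  apply: norm_cvg0.
  apply: (@squeeze_cvgr _ _ _ _ (cst 0) (fun n => C * `|x0 - x n|)).
  - by near=> n; rewrite /= normr_ge0/=; near: n; apply: filterS tC => n; exact.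
  - exact: cvg_cst.
  - rewrite -[0](mulr0 C) -[X in C * X](@normr0 _ X) -(subrr x0).
    by apply: cvgMr; apply: cvg_norm; apply: cvgB => //; exact: cvg_cst.
(* The limit is taken for each real [a] below [g x0], which does not presuppose that [g x0] is
   finite. *)
have gx0 v : g v \is a fin_num -> (g x0 <= (fine (g v) - t0 (v - x0))%:E)%E.
  move=> gv; have lim a : (a%:E < g x0)%E -> a <= fine (g v) - t0 (v - x0).
    move=> /glsc[V V0 Va].
    apply: (@cvgr_to_ge _ \oo _ _ (fun n => fine (g v) - t n (v - x n))).
      exact: (cvgB (cvg_cst _) (tx v)).
    near=> n.
    have /Va : V (x n) by near: n; exact: xx0.
    rewrite -(fineK (subdifferential_fin_num gp (tg n))) lte_fin => /ltW.
    by have := subdifferential_fineP gp (tg n) gv; lra.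
  move: lim; case: (g x0) => [r| |] lim; last by rewrite leNye.
    rewrite lee_fin; apply/ler_addgt0Pr => e e0.
    by rewrite -lerBlDr lim// lte_fin gtrBl.
  (* If [g x0] were [+oo], every real would lie below it, including the bound plus 1. *)
  exfalso; have := lim (fine (g v) - t0 (v - x0) + 1).
  by rewrite ltry => /(_ isT); lra.
have [gNy [v0 v0y]] := gp.
have gx0f : g x0 \is a fin_num.
  have gv0 : g v0 \is a fin_num by rewrite fin_numElt gNy.
  by rewrite fin_numElt gNy/= (le_lt_trans (gx0 v0 gv0)) ?ltry.
move=> v; have [gv|] := boolP (g v \is a fin_num).
  have := gx0 v gv; rewrite -{2}(fineK gv) -(fineK gx0f) -EFinB !lee_fin; lra.
rewrite fin_numElt gNy/= -leNgt leye_eq => /eqP ->.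
by rewrite -(fineK gx0f) addye// leey.
Unshelve. all: by end_near.
Qed.

Lemma inexact_DCA_steps_cvg0 g h (u : nat -> X) (s eps : nat -> dual X) :
  proper_fun g -> bounded_below (fun u => g u - (h u)%:E)%E ->
  strongly_convex g \/ strongly_convex (EFin \o h) ->
  inexact_DCA g h u s eps ->
  (\sum_(1 <= k <oo) (dual_norm (eps k) ^+ 2)%:E < +oo)%E ->
  u k - u k.+1 @[k --> \oo] --> 0.
Proof.
move=> gp [m fm] sc dca epsS.
(* [g (u 0)] may be infinite, so the descent estimate starts at [u 1]. *)
have guf k : g (u k.+1) \is a fin_num := subdifferential_fin_num gp (dca k).2.
have hp := proper_fun_EFin h.
have [c c0 desc] : exists2 c, 0 < c & forall k,
    c * `|u k.+1 - u k.+2| ^+ 2 + eps k.+1 (u k.+1 - u k.+2) <=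
    (fine (g (u k.+1)) - h (u k.+1)) - (fine (g (u k.+2)) - h (u k.+2)).
  (* The strongly convex function supplies the quadratic term, the other one its plain subgradient
     inequality. *)
  case: sc => [/(strongly_convex_subdifferential gp)|
      /(strongly_convex_subdifferential hp)] [c c0 sc]; exists c => // k.
  - have := sc _ _ _ (dca k.+1).2 (guf k).
    have := @subdifferential_fineP _ _ _ (u k.+2) hp (dca k.+1).1 isT.
    by rewrite dualDE -(opprB (u k.+1) (u k.+2)) linearN/=; lra.
  - have := subdifferential_fineP gp (dca k.+1).2 (guf k).
    have := sc _ (u k.+2) _ (dca k.+1).1 isT.
    by rewrite dualDE distrC -(opprB (u k.+1) (u k.+2)) linearN/=; lra.
pose F k := fine (g (u k.+1)) - h (u k.+1).
pose e k := dual_norm (eps (k + 1)%N).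
pose d k := `|u k.+1 - u k.+2|.
have Fm k : m <= F k.
  by rewrite /F -lee_fin EFinB fineK.
(* Young's inequality absorbs [e k * d k] into half of the quadratic gain. *)
have dF k : c / 2 * d k ^+ 2 <= F k - F k.+1 + (2 * c)^-1 * e k ^+ 2.
  have := desc k; rewrite -/(d k) -/(F k) -/(F k.+1).
  have := dual_normP (eps k.+1) (u k.+1 - u k.+2).
  rewrite -/(d k) ler_norml => /andP[+ _].
  rewrite /e addn1; set E := dual_norm _; set z := eps _ _.
  have : 0 <= (2 * c)^-1 * (E - c * d k) ^+ 2.
    by rewrite mulr_ge0 ?sqr_ge0// invr_ge0 mulr_ge0// ltW.
  have -> : (2 * c)^-1 * (E - c * d k) ^+ 2 =
      (2 * c)^-1 * E ^+ 2 - E * d k + c / 2 * d k ^+ 2 by field; rewrite gt_eqF.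
  by lra.
have [M eM] := nneseries_lty_bounded (fun k => sqr_ge0 (dual_norm (eps k))) epsS.
have d20 : c / 2 * d k ^+ 2 @[k --> \oo] --> 0.
  (* Telescoping [dF] leaves [F 0 - F n], at most [F 0 - m], plus the weighted sum of the squared
     errors. *)
  apply: (@nonneg_bounded_sum_cvg0 _ _ (F 0%N - m + (2 * c)^-1 * M)) => [k|n].
    by rewrite mulr_ge0 ?sqr_ge0// divr_ge0// ltW.
  apply: (@le_trans _ _ (F 0%N - F n + (2 * c)^-1 * \sum_(0 <= k < n) e k ^+ 2)).
    elim: n => [|n IHn]; first by rewrite !big_geq// mulr0 subrr addr0.
    by rewrite !big_nat_recr//= mulrDr; have := dF n; lra.
  by rewrite lerD ?lerB// ler_wpM2l// invr_ge0 mulr_ge0// ltW.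
rewrite -cvg_shiftS; apply: norm_cvg0; apply: sqr_cvg0.
have -> : (fun k => `|u k.+1 - u k.+2| ^+ 2) =
          (fun k => (c / 2)^-1 * (c / 2 * d k ^+ 2)).
  by apply/funext => k; rewrite mulKf// gt_eqF// divr_gt0.
by rewrite -[0](mulr0 (c / 2)^-1); exact: cvgMr.
Qed.

End subdifferential_theory.

Theorem theorem4p7 (R : realType) (X : completeNormedModType R)
    (g : X -> \bar R) (h : X -> R)
    (g_proper : proper_fun g) (g_convex : econvex g)
    (g_lsc : lower_semicontinuous g)
    (h_convex : convex_function [set: X] h) (h_cont : continuous h)
    (f_bounded : bounded_below (fun u => g u - (h u)%:E)%E)
    (gh_strongly_convex : strongly_convex g \/ strongly_convex (EFin \o h))
    (u : nat -> X) (s eps : nat -> dual X)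
    (dca : inexact_DCA g h u s eps)
    (kn : nat -> nat) (kn_incr : increasing_seq kn)
    (ubar : X) (sbar : dual X)
    (u_cvg : u (kn n) @[n --> \oo] --> ubar)
    (s_cvg : weak_star_cvg (fun n => s (kn n)) sbar)
    (eps_summable : (\sum_(1 <= k <oo) (dual_norm (eps k) ^+ 2)%:E < +oo)%E) :
  (subdifferential g ubar `&` subdifferential (EFin \o h) ubar) sbar /\
  critical_point g h ubar.
Proof.
suff : (subdifferential g ubar `&` subdifferential (EFin \o h) ubar) sbar.
  by move=> ssub; split; last exists sbar.
have knoo : kn n @[n --> \oo] --> \oo.
  have kn_ge n : (n <= kn n)%N.
    elim: n => // n IHn; apply: leq_ltn_trans IHn _.
    by have /increasing_seqP := kn_incr; exact.
  by move=> P [N _ NP]; exists N => // n Nn; apply/NP/(leq_trans Nn).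
have [C hC] := subdifferential_locally_bounded (h_cont ubar).
have sC : \forall n \near \oo, forall w, `|s (kn n) w| <= C * `|w|.
  have : \forall n \near \oo, forall t,
      subdifferential (EFin \o h) (u (kn n)) t -> forall w, `|t w| <= C * `|w|.
    exact: u_cvg _ hC.
  by apply: filterS => n; apply; exact: (dca (kn n)).1.
have eps0 : dual_norm (eps (kn n)) @[n --> \oo] --> 0.
  have [M epsM] :=
    nneseries_lty_bounded (fun k => sqr_ge0 (dual_norm (eps k))) eps_summable.
  have eps20 := nonneg_bounded_sum_cvg0 (fun k => sqr_ge0 _) epsM.
  have : dual_norm (eps k) @[k --> \oo] --> 0.
    by rewrite -cvg_shiftS; apply: sqr_cvg0; under eq_fun do rewrite -addn1.
  exact: (cvg_comp kn).
have du : u (kn n) - u (kn n).+1 @[n --> \oo] --> 0.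
  apply: (cvg_comp kn (fun k => u k - u k.+1) knoo).
  exact: (inexact_DCA_steps_cvg0 g_proper f_bounded gh_strongly_convex dca).
split; last first.
  apply: (subdifferential_closed (proper_fun_EFin h) _ u_cvg s_cvg sC) => [x a|n].
    rewrite lte_fin => ahx; exists [set y | a < h y].
      by have /cvgr_gt := h_cont x; exact.
    by move=> y /=; rewrite lte_fin.
  exact: (dca (kn n)).1.
(* The errors tend to 0 in norm, so adding them keeps the weak-* limit [sbar]; their norms are
   eventually at most 1, whence [C + 1]. *)
apply: (@subdifferential_closed _ _ _ (fun n => u (kn n).+1)
    (fun n => s (kn n) + eps (kn n)) _ _ (C + 1)) => // [|x||n].
- have -> : (fun n => u (kn n).+1) =
            (fun n => u (kn n)) - (fun n => u (kn n) - u (kn n).+1).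
    by apply/funext => n; rewrite !fctE subKr.
  by rewrite -[ubar]subr0; exact: cvgB.
- under eq_fun do rewrite dualDE.
  rewrite -[sbar x]addr0; apply: cvgD; first exact: s_cvg.
  apply: norm_cvg0.
  apply: (@squeeze_cvgr _ \oo _ _ (cst 0)
    (fun n => dual_norm (eps (kn n)) * `|x|)).
  + by near=> n; rewrite normr_ge0 dual_normP.
  + exact: cvg_cst.
  + by rewrite -[0](mul0r `|x|); exact: cvgMl.
- near=> n => w.
  rewrite dualDE mulrDl (le_trans (ler_normD _ _))// lerD//.
    by move: w; near: n.
  rewrite (le_trans (dual_normP _ _))// ler_wpM2r//.
  by near: n; apply: cvgr_le eps0 _ _.
- exact: (dca (kn n)).2.
Unshelve. all: by end_near.
Qed.
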